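(* For every propositional formula $\phi$ (i.e. built from atoms in $AP$ using only $\neg$ and $\land$) and every $A\subseteq Ag$, the formulas $$[\phi]^-_A E_A\phi \qquad\text{and}\qquad [\phi]^+_A C_A\phi$$ are valid, i.e. satisfied at every world of every Kripke model.
   Context: Language. $AP$ is a set of atoms and $Ag$ a finite set of agents. The formulas of $\mathcal{L}_{glal}$ are given, for $p\in AP$ and $A\subseteq Ag$, by $\psi ::= p \mid \neg\psi \mid \psi\land\psi \mid C_A\psi \mid [\psi]^+_A\psi \mid [\psi]^-_A\psi$. Abbreviations: $K_a\psi := C_{\{a\}}\psi$ and $E_A\psi := \bigwedge_{a\in A}K_a\psi$. Models. A (Kripke) model is $\mathcal{M}=\langle W,\{R_a\}_{a\in Ag},V\rangle$ with $W$ a set of worlds, each $R_a$ an equivalence relation on $W$, and $V:AP\to 2^W$. For $w\in W$, $R_a(w)=\{w' : R_a(w,w')\}$; for $A\subseteq Ag$, $R^C_A=(\bigcup_{a\in A}R_a)^*$ is the reflexive-transitive closure and $R^C_A(w)=\{w' : R^C_A(w,w')\}$. Semantics. The satisfaction set $[\![\varphi]\!]_{\mathcal{M}}\subseteq W$ is defined by: $[\![p]\!]_{\mathcal{M}}=V(p)$; $[\![\neg\psi]\!]_{\mathcal{M}}=W\setminus[\![\psi]\!]_{\mathcal{M}}$; $[\![\psi\land\psi']\!]_{\mathcal{M}}=[\![\psi]\!]_{\mathcal{M}}\cap[\![\psi']\!]_{\mathcal{M}}$; $[\![C_A\psi]\!]_{\mathcal{M}}=\{w : R^C_A(w)\subseteq[\![\psi]\!]_{\mathcal{M}}\}$;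 and for $\star\in\{+,-\}$, $[\![[\psi]^\star_A\psi']\!]_{\mathcal{M}}=\{w : \text{if } w\in[\![\psi]\!]_{\mathcal{M}} \text{ then } w\in[\![\psi']\!]_{\mathcal{M}^\star_{(w,\psi,A)}}\}$. The refinements $\mathcal{M}^-_{(w,\psi,A)}$ and $\mathcal{M}^+_{(w,\psi,A)}$ have the same worlds and valuation as $\mathcal{M}$ and relations $R^-_b=R^+_b=R_b$ for $b\notin A$, while for $a\in A$: $R^-_a(v)=R_a(v)\cap[\![\psi]\!]_{\mathcal{M}}$ if $v\in R_a(w)\cap[\![\psi]\!]_{\mathcal{M}}$; $R^-_a(v)=R_a(v)\cap[\![\neg\psi]\!]_{\mathcal{M}}$ if $v\in R_a(w)\cap[\![\neg\psi]\!]_{\mathcal{M}}$; $R^-_a(v)=R_a(v)$ otherwise; and $R^+_a(v)$ is defined by the same three cases with $R_a(w)$ replaced by $R^C_A(w)$ in the case conditions. A formula $\varphi$ is satisfied at $w$ in $\mathcal{M}$, $(\mathcal{M},w)\models\varphi$, if $w\in[\![\varphi]\!]_{\mathcal{M}}$. *)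

(* Defs.v *)
From Stdlib Require Export Relation_Definitions Relation_Operators.
From mathcomp Require Export all_boot.
From mathcomp Require Export boolp classical_sets.

Set Implicit Arguments.
Unset Strict Implicit.
Unset Printing Implicit Defensive.

Local Open Scope classical_set_scope.

Inductive form (AP : Type) (Ag : finType) : Type :=
| Atom of AP
| Neg of form AP Ag
| And of form AP Ag & form AP Ag
| CK of {set Ag} & form AP Ag
| AnnP of form AP Ag & {set Ag} & form AP Ag  (* [psi]^+_A psi' *)
| AnnM of form AP Ag & {set Ag} & form AP Ag. (* [psi]^-_A psi' *)
Arguments Atom {AP Ag}.

Definition K (AP : Type) (Ag : finType) (a : Ag) (psi : form AP Ag) : form AP Ag :=
  CK (finset.set1 a) psi.

(* The argument top stands for the empty conjunction. *)
Fixpoint Ands (AP : Type) (Ag : finType) (top : form AP Ag)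
    (s : seq (form AP Ag)) : form AP Ag :=
  match s with
  | [::] => top
  | [:: psi] => psi
  | psi :: s' => And psi (Ands top s')
  end.

(* The language has no primitive truth constant, and AP may be empty, so for
   empty A the conjunction is the tautology ~ (psi /\ ~ psi). *)
Definition EK (AP : Type) (Ag : finType) (A : {set Ag}) (psi : form AP Ag) :
    form AP Ag :=
  Ands (Neg (And psi (Neg psi))) [seq K a psi | a <- enum A].

Fixpoint propositional (AP : Type) (Ag : finType) (psi : form AP Ag) : bool :=
  match psi with
  | Atom _ => true
  | Neg psi1 => propositional psi1
  | And psi1 psi2 => propositional psi1 && propositional psi2
  | CK _ _ | AnnP _ _ _ | AnnM _ _ _ => false
  end.

(* R a w is the set R_a(w); as a relation, R a w w' reads R_a(w, w'). *)
Record model (AP : Type) (Ag : finType) : Type := Model {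
  world :> Type;
  R : Ag -> world -> set world;
  R_equiv : forall a, equivalence world (R a);
  V : AP -> set world
}.

Definition RC (AP : Type) (Ag : finType) (M : model AP Ag) (A : {set Ag}) :
    M -> set M :=
  clos_refl_trans M (fun v v' => exists2 a, a \in A & R a v v').

(* The definition by cases common to both refinements: P is the satisfaction
   set of the announced formula, and D a is the set R_a(w) or R^C_A(w) that
   occurs in the case conditions for agent a. *)
Definition refine_R (AP : Type) (Ag : finType) (M : model AP Ag) (A : {set Ag})
    (P : set M) (D : Ag -> set M) (a : Ag) (v : M) : set M :=
  if a \in A then
    if v \in D a `&` P then R a v `&` P
    else if v \in D a `&` ~` P then R a v `&` ~` P
    else R a v
  else R a v.

Lemma refine_R_equiv (AP : Type) (Ag : finType) (M : model AP Ag) (A : {set Ag})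
    (P : set M) (D : Ag -> set M) :
  (forall a, a \in A -> forall v v', R a v v' -> D a v -> D a v') ->
  forall a, equivalence M (refine_R A P D a).
Proof.
move=> closedD a; have [refl_R trans_R sym_R] := R_equiv M a.
have [aA|naA] := boolP (a \in A); last first.
  suff -> : refine_R A P D a = R a by exact: R_equiv.
  by apply: funext => v; rewrite /refine_R (negbTE naA).
have refineE v v' :
    refine_R A P D a v v' <-> R a v v' /\ (D a v -> (P v <-> P v')).
  rewrite /refine_R aA.
  case: ifPn => [/set_mem[Dv Pv]|/negP/mem_set nDP].
    by split=> [[Rvv' Pv']|[Rvv' /(_ Dv)[PP' _]]]; split=> //; exact: PP'.
  case: ifPn => [/set_mem[Dv nPv]|/negP/mem_set nDnP].
    split=> [[Rvv' nPv']|[Rvv' /(_ Dv)[_ P'P]]]; split=> // Pv'.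
    exact/nPv/P'P.
  split=> [Rvv'|[]//]; split=> // Dv; exfalso.
  have [Pv|nPv] := pselect (P v).
    by move/set_mem: nDP; apply; apply/mem_set.
  by move/set_mem: nDnP; apply; apply/mem_set.
split.
- by move=> v; apply/refineE.
- move=> v1 v2 v3 /refineE[R12 P12] /refineE[R23 P23]; apply/refineE.
  split=> [|D1]; first exact: trans_R R12 R23.
  by rewrite P12 // P23 //; exact: closedD R12 D1.
- move=> v1 v2 /refineE[R12 P12]; apply/refineE.
  have R21 := sym_R _ _ R12; split=> // D2.
  by rewrite P12 //; exact: closedD R21 D2.
Qed.

Lemma closed_R (AP : Type) (Ag : finType) (M : model AP Ag) (A : {set Ag}) (w : M) :
  forall a, a \in A -> forall v v', R a v v' -> R a w v -> R a w v'.
Proof.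
by move=> a _ v v' Rvv' Rwv; case: (R_equiv M a) => _ trans_R _; apply: trans_R Rvv'.
Qed.

Lemma closed_RC (AP : Type) (Ag : finType) (M : model AP Ag) (A : {set Ag}) (w : M) :
  forall a, a \in A -> forall v v', R a v v' -> RC A w v -> RC A w v'.
Proof.
by move=> a aA v v' Rvv' Cwv; apply: rt_trans Cwv _; apply: rt_step; exists a.
Qed.

Definition refineM (AP : Type) (Ag : finType) (M : model AP Ag) (w : M)
    (P : set M) (A : {set Ag}) : model AP Ag :=
  @Model AP Ag M (refine_R A P (fun a => R a w))
    (@refine_R_equiv AP Ag M A P (fun a => R a w)
      (@closed_R AP Ag M A w)) (@V AP Ag M).

Definition refineP (AP : Type) (Ag : finType) (M : model AP Ag) (w : M)
    (P : set M) (A : {set Ag}) : model AP Ag :=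
  @Model AP Ag M (refine_R A P (fun=> RC A w))
    (@refine_R_equiv AP Ag M A P (fun=> RC A w)
      (@closed_RC AP Ag M A w)) (@V AP Ag M).

Unset Implicit Arguments.
Fixpoint sem {AP : Type} {Ag : finType} (psi : form AP Ag) (M : model AP Ag)
    {struct psi} : set M :=
  match psi with
  | Atom p => V p
  | Neg psi1 => ~` sem psi1 M
  | And psi1 psi2 => sem psi1 M `&` sem psi2 M
  | CK A psi1 => [set w | RC A w `<=` sem psi1 M]
  | AnnP psi1 A psi2 =>
      [set w : M | sem psi1 M w -> sem psi2 (refineP w (sem psi1 M) A) w]
  | AnnM psi1 A psi2 =>
      [set w : M | sem psi1 M w -> sem psi2 (refineM w (sem psi1 M) A) w]
  end.
Set Implicit Arguments.

Definition valid (AP : Type) (Ag : finType) (psi : form AP Ag) : Prop :=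
  forall (M : model AP Ag) (w : M), sem psi M w.

(* Main.v *)
Require Import Defs.

Set Implicit Arguments.
Unset Strict Implicit.
Unset Printing Implicit Defensive.

Local Open Scope classical_set_scope.

(* Propositional formulas do not see the relations, so phi has the same
   satisfaction set before and after a refinement. From a phi-world in the
   scope of the announcement, a refined step of an agent of A leads to another
   such world; hence phi holds at everything reachable from w. *)

(** Both models are written as [Model] on one carrier [W], so that the two satisfaction sets have
    the same type and can be equated. *)
Lemma sem_propositional (AP : Type) (Ag : finType) (W : Type)
    (R1 R2 : Ag -> W -> set W) (eq1 : forall a, equivalence W (R1 a))
    (eq2 : forall a, equivalence W (R2 a)) (V : AP -> set W)
    (phi : form AP Ag) :
  propositional phi -> sem phi (Model eq1 V) = sem phi (Model eq2 V).
Proof.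
elim: phi => //= [psi IH /IH -> //|psi1 IH1 psi2 IH2 /andP[/IH1 -> /IH2 -> //]].
Qed.

Lemma sem_Ands_map (AP : Type) (Ag : finType) (M : model AP Ag) (w : M)
    (I : eqType) (top : form AP Ag) (f : I -> form AP Ag) (s : seq I) :
  sem top M w -> {in s, forall i, sem (f i) M w} ->
  sem (Ands top [seq f i | i <- s]) M w.
Proof.
move=> top_w; elim: s => [//|i s IH] f_w.
have fi : sem (f i) M w by apply: f_w; rewrite mem_head.
have {}IH : sem (Ands top [seq f j | j <- s]) M w.
  by apply: IH => j js; apply: f_w; rewrite inE js orbT.
(* [Ands] treats a singleton separately, so an [And] appears only once the tail is known to be
   nonempty. *)
by case: s IH {f_w} => [//|j s IH]; split.
Qed.

(** At a point of [D a] satisfying [P], the first case of the refinement applies and keeps only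
    successors in [P]. *)
Lemma refine_R_closed (AP : Type) (Ag : finType) (M : model AP Ag)
    (A : {set Ag}) (P : set M) (D : Ag -> set M) (a : Ag) (v v' : M) :
  (forall v v', R a v v' -> D a v -> D a v') -> a \in A ->
  refine_R A P D a v v' -> (D a `&` P) v -> (D a `&` P) v'.
Proof.
move=> closedD aA + DPv; rewrite /refine_R aA (mem_set DPv) => -[Rvv' Pv'].
by split=> //; exact: closedD Rvv' DPv.1.
Qed.

Lemma RC_sub_closed (AP : Type) (Ag : finType) (M : model AP Ag) (A : {set Ag})
    (Q : set M) (w : M) :
  (forall a v v', a \in A -> R a v v' -> Q v -> Q v') -> Q w -> RC A w `<=` Q.
Proof.
move=> closedQ Qw v Cwv.
elim: Cwv Qw => [x y [a aA Rxy]|//|x y z _ IH1 _ IH2 /IH1/IH2 //].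
exact: closedQ aA Rxy.
Qed.

Theorem proposition4 (AP : Type) (Ag : finType) (phi : form AP Ag) (A : {set Ag}) :
  propositional phi ->
  valid (AnnM phi A (EK A phi)) /\ valid (AnnP phi A (CK A phi)).
Proof.
move=> prop_phi; split=> M w /= Pw.
- apply: sem_Ands_map => [[]//|a]; rewrite mem_enum => aA /=.
  have -> : sem phi (refineM w (sem phi M) A) = sem phi M.
    (* Destructing [M] exposes the [Model] form; the refinement shares its carrier and valuation. *)
    by case: M w {Pw} => W RM eqR VM w; exact: sem_propositional.
  (* The invariant uses the relation of [M] before refinement. Only [a] moves under [K a], so the
     scope [R a w] is never left. *)
  apply: (@subset_trans _ (R a w `&` sem phi M)); last exact: subIsetr.
  apply: (@RC_sub_closed _ _ (refineM w _ A)) => [b v v' /set1P -> /=|].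
    by apply: (refine_R_closed _ aA); exact: closed_R aA.
  by split=> //; case: (R_equiv M a) => refl_R _ _; exact: refl_R.
- have -> : sem phi (refineP w (sem phi M) A) = sem phi M.
    by case: M w {Pw} => W RM eqR VM w; exact: sem_propositional.
  (* Here every agent of [A] may move, and [RC A w] is closed under the steps of all of them. *)
  apply: (@subset_trans _ (RC A w `&` sem phi M)); last exact: subIsetr.
  apply: (@RC_sub_closed _ _ (refineP w _ A)) => [a v v' aA /=|].
    by apply: (refine_R_closed (D := fun=> RC A w) _ aA); exact: closed_RC aA.
  by split=> //; exact: rt_refl.
Qed.
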